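(* The strong terminating conjecture holds globally for the system $[0,x,1,1]$. Specifically, for every $x\in\mathbb{R}$ we have $\tau(x)\leqslant 63$ and $$m(x)=Y_{63}(x)=\begin{cases}1&\text{if }x\leqslant-\frac{1}{387}\\ -\frac{387}{2}x+\frac12&\text{if }-\frac{1}{387}<x<0\\ 194x+\frac12&\text{if }0\leqslant x<\frac{1}{388}\\ 1&\text{if }x\geqslant\frac{1}{388}.\end{cases}$$
   Context: Mean-median map: for a finite multiset $[x_1,\ldots,x_n]$ of real numbers with arithmetic mean $\langle x_1,\ldots,x_n\rangle$ and median $\mathcal{M}(x_1,\ldots,x_n)$ (the average of the two central elements if $n$ is even), one adjoins $x_{n+1}=(n+1)\mathcal{M}(x_1,\ldots,x_n)-n\langle x_1,\ldots,x_n\rangle$, and iterates. For the system $[0,x,1,1]$ with $x\in\mathbb{R}$, set $Y_1(x)=0$, $Y_2(x)=x$, $Y_3(x)=Y_4(x)=1$, and let $Y_{n+1}(x)=(n+1)\mathcal{M}(Y_1(x),\ldots,Y_n(x))-n\langle Y_1(x),\ldots,Y_n(x)\rangle$ for $n\geqslant4$. The transit time $\tau(x)$ is the least integer $\tau$ such that $Y_{\tau+k}(x)=Y_\tau(x)$ for all $k\in\mathbb{N}$ ($\tau(x)=\infty$ if there is none), and $m(x)=\lim_{n\to\infty}Y_n(x)$ is the limit function. The strong terminating conjecture for a system asserts that $\tau(x)<\infty$ for every $x$. *)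

(* Defs.v *)
From HB Require Import structures.
From mathcomp Require Import all_boot all_order all_algebra.
From mathcomp Require Import all_classical all_reals all_analysis.

Set Implicit Arguments.
Unset Strict Implicit.
Unset Printing Implicit Defensive.

Import Order.TTheory GRing.Theory Num.Theory.
Import numFieldNormedType.Exports.

Local Open Scope classical_set_scope.
Local Open Scope ring_scope.

Section MeanMedianMap.
Variable R : realType.
Implicit Types (s : seq R) (Y : nat -> R).

Definition mean s : R := (\sum_(y <- s) y) / (size s)%:R.

Definition median s : R :=
  let t := sort <=%O s in
  let n := size s in
  if odd n then t`_n./2 else (t`_n./2.-1 + t`_n./2) / 2%:R.

(* The number adjoined to the n-element multiset s: (n + 1) M(s) - n <s>. *)
Definition mm_next s : R :=
  (size s).+1%:R * median s - (size s)%:R * mean s.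

(* The multiset is kept as a list in order of creation. *)
Definition mm_step s : seq R := rcons s (mm_next s).

(* The sequence generated by s0, numbered from 1 as in x_1, x_2, and so on;
   the value at n = 0 is meaningless. The n-th iterate of mm_step has at least
   n terms, and mm_step leaves the existing terms unchanged. *)
Definition mm_seq (s0 : seq R) (n : nat) : R := (iter n mm_step s0)`_n.-1.

Lemma mm_seq_init (s0 : seq R) n : (0 < n <= size s0)%N ->
  mm_seq s0 n = s0`_n.-1.
Proof.
case: n => [//|n] /= lt_n; rewrite /mm_seq /=.
suff H k : (n < size (iter k mm_step s0))%N /\
  (iter k mm_step s0)`_n = s0`_n by case: (H n.+1).
elim: k => [//|k [ltk IHk]] /=.
by rewrite size_rcons nth_rcons ltk (leqW ltk).
Qed.

Lemma mm_seqS (s0 : seq R) n : (0 < n)%N -> (size s0 <= n)%N ->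
  mm_seq s0 n.+1 =
    n.+1%:R * median [seq mm_seq s0 i | i <- iota 1 n]
    - n%:R * mean [seq mm_seq s0 i | i <- iota 1 n].
Proof.
move=> n_gt0 le_sn.
have size_it k : size (iter k mm_step s0) = (size s0 + k)%N.
  by elim: k => [|k IHk] /=; rewrite ?addn0 // size_rcons IHk addnS.
have stab i j k : (i < size s0 + j)%N ->
    (iter (j + k) mm_step s0)`_i = (iter j mm_step s0)`_i.
  move=> lti; elim: k => [|k IHk]; first by rewrite addn0.
  rewrite addnS /= nth_rcons size_it IHk ifT //.
  by rewrite addnA ltn_addr.
pose m := (n - size s0)%N.
have sm : size (iter m mm_step s0) = n by rewrite size_it subnKC.
have -> : [seq mm_seq s0 i | i <- iota 1 n] = iter m mm_step s0.
  apply: (@eq_from_nth _ 0) => [|i]; rewrite size_map size_iota ?sm // => lti.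
  rewrite (nth_map 0%N) ?size_iota // nth_iota // add1n /mm_seq.
  rewrite -(stab i i.+1 m); last by rewrite addnS ltnS leq_addl.
  by rewrite addnC stab // subnKC.
have {1}-> : mm_seq s0 n.+1 = (iter m.+1 mm_step s0)`_n.
  rewrite /mm_seq -{1}(subnK le_sn) -addSn stab //.
  by rewrite -/m addnS subnKC.
by rewrite /= nth_rcons sm ltnn eqxx /mm_next sm.
Qed.

Definition stationary_from Y (t : nat) : Prop := forall k, Y (t + k)%N = Y t.

(* Only indices t >= 1 belong to the sequence. *)
Definition transit_pred Y : pred nat :=
  fun t => (0 < t)%N && `[< stationary_from Y t >].

Definition transit_time Y : \bar int :=
  if pselect (exists t, transit_pred Y t) is left ex
  then (Posz (ex_minn ex))%:E else +oo%E.

Definition Y0x11 (n : nat) (x : R) : R := mm_seq [:: 0; x; 1; 1] n.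

Definition tau0x11 (x : R) : \bar int := transit_time (Y0x11^~ x).

Definition m0x11 (x : R) : R := limn (Y0x11^~ x).

Definition strong_terminating (tau : R -> \bar int) : Prop :=
  forall x, (tau x < +oo)%E.

End MeanMedianMap.

(* Main.v *)
From Stdlib Require Import ZArith.
Require Import Defs.
From HB Require Import structures.
From mathcomp Require Import all_boot all_order all_algebra.
From mathcomp Require Import all_classical all_reals all_analysis.
From mathcomp Require Import ssrZ ring lra zify.

Import Order.TTheory GRing.Theory Num.Theory.
Import numFieldNormedType.Exports.

Local Open Scope classical_set_scope.
Local Open Scope ring_scope.

(** The sequence becomes constant as soon as one adjoined element equals the
    current median: adjoining the median changes neither the median nor the
    next element ([mm_stationary]). So it suffices to see this happen, for each
    real x, while the list has at most 62 elements.

    On an interval of x where the order of the terms does not change, every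
    term is an affine function of x, and the orbit can be computed exactly. The
    real line is thus cut at finitely many rational points (there are about 950
    pieces), and on each piece the affine orbit is run until it meets its own
    median; its common value from then on is compared with the claimed one.

    The cutting is found by the same computation. By homogeneity of the map, a
    piece is described by two rational endpoints given as projective vectors
    (numerator, denominator), which also covers the two half-lines, whose far
    endpoint has denominator 0. Each x in the piece is a nonnegative
    combination, with coefficients a and b, of the two endpoints, and a term of
    the orbit is stored as the pair of integers (u, v) that stands for
    a u + b v. If u <= u' and v <= v' then the term (u, v) is at most the term
    (u', v') throughout the piece; if two terms are not comparable in this way,
    their difference changes sign inside, and [explore] cuts the piece at that
    zero and starts again on both sides. Cutting is always sound, whatever the
    point, since any x lies on one side or on the other. Soundness of a
    completed run is [run_sound], of the whole search [explore_sound]. *)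

(** * The mean-median map *)

Section MeanMedian.
Variable R : realType.
Implicit Types (s t : seq R) (m : R).

Definition central_value t : R :=
  if odd (size t) then t`_(size t)./2
  else (t`_(size t)./2.-1 + t`_(size t)./2) / 2%:R.

Lemma median_of_sorted {t} {s} :
  sorted <=%O t -> perm_eq t s -> median s = central_value t.
Proof.
move=> t_sorted ts; have -> : median s = central_value (sort <=%O s).
  by rewrite /median /central_value size_sort.
congr central_value; apply: le_sorted_eq => //; first exact: sort_le_sorted.
by rewrite perm_sort perm_sym.
Qed.

Lemma mm_nextE s :
  mm_next s = (size s).+1%:R * median s - \sum_(y <- s) y.
Proof.
rewrite /mm_next /mean; congr (_ - _).
have [/size0nil->|s_neq0] := eqVneq (size s) 0%N.
  by rewrite big_nil mul0r.
by rewrite mulrC divfK // pnatr_eq0.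
Qed.

Lemma sum_mm_step s :
  \sum_(y <- mm_step s) y = (size s).+1%:R * median s.
Proof. by rewrite /mm_step -cats1 big_cat big_seq1 mm_nextE /=; ring. Qed.

(** The median can be inserted exactly in the middle of the sorted list: the
    two halves of that list lie on either side of it. *)
Lemma median_rcons_median s : (0 < size s)%N ->
  median (rcons s (median s)) = median s.
Proof.
move=> s_gt0; set m := median s; pose t := sort <=%O s; pose k := (size t)./2.
have t_sorted : sorted <=%O t by exact: sort_le_sorted.
have st : size t = size s by exact: size_sort.
have ts : perm_eq t s by rewrite perm_sort.
have m_central : m = central_value t by exact: median_of_sorted.
have t_gt0 : (0 < size t)%N by rewrite st.
have k_lt : (k < size t)%N by rewrite /k; lia.
have t_mono i j : (i <= j)%N -> (j < size t)%N -> t`_i <= t`_j.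
  move=> ij jt; apply: (sorted_leq_nth le_trans lexx) => //.
  by rewrite inE (leq_ltn_trans ij).
have m_le : m <= t`_k.
  rewrite m_central /central_value -/k; case: ifP => // _.
  have := t_mono k.-1 k (leq_pred k) k_lt; lra.
have le_m i : (i < k)%N -> t`_i <= m.
  move=> ik; rewrite m_central /central_value -/k; case: ifP => _.
    by apply: t_mono => //; exact: ltnW.
  have := t_mono i k.-1 ltac:(lia) ltac:(lia).
  have := t_mono i k (ltnW ik) k_lt; lra.
(* m lies between the entries of index k - 1 and k of t. *)
pose t' := take k t ++ m :: drop k t.
have t's : perm_eq t' (rcons s m).
  rewrite /t' -cat1s perm_catCA cat_take_drop perm_sym.
  by rewrite perm_rcons /= perm_cons perm_sym.
have size_take_k : size (take k t) = k by rewrite size_take k_lt.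
have t'_nth i : t'`_i = if (i < k)%N then t`_i
                        else if i == k then m else t`_i.-1.
  rewrite /t' nth_cat size_take_k; case: ltnP => [ik|ki].
    by rewrite nth_take.
  have [->|nik] := eqVneq i k; first by rewrite subnn.
  have -> : (i - k = (i.-1 - k).+1)%N by lia.
  by rewrite /= nth_drop; congr (t`_ _); lia.
have size_t' : size t' = (size t).+1 by rewrite (perm_size t's) size_rcons st.
have t'_sorted : sorted <=%O t'.
  apply/(sortedP 0) => i; rewrite size_t' !t'_nth ltnS => it.
  case: (ltngtP i k) => [ik|ki|->].
  - have [?|?|_] := ltngtP i.+1 k; [|lia|exact: le_m].
    by apply: t_mono; lia.
  - by have [?|_|?] := ltngtP i.+1 k; [lia| |lia]; apply: t_mono; lia.
  - by have [?|_|?] := ltngtP k.+1 k; [lia| |lia].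
rewrite (median_of_sorted t'_sorted t's) /central_value size_t' /=.
case: ifPn => [t_even|]; [|rewrite negbK => t_odd].
  have -> : uphalf (size t) = k by rewrite /k; lia.
  by rewrite t'_nth ltnn eqxx.
have -> : uphalf (size t) = k.+1 by rewrite /k; lia.
rewrite !t'_nth /= ltnn eqxx ltnNge leqnSn gtn_eqF //= m_central.
by rewrite /central_value t_odd -/k; lra.
Qed.

(** Adjoining the median shifts the sum by the median, so the next element to
    be adjoined is the median again. *)
Lemma mm_stationary s k : (0 < size s)%N -> mm_next s = median s ->
  mm_next (iter k (@mm_step R) s) = median s.
Proof.
move=> s_gt0 next_s.
suff [] : (0 < size (iter k (@mm_step R) s))%N /\
    [/\ mm_next (iter k (@mm_step R) s) = median s
      & median (iter k (@mm_step R) s) = median s] by move=> _ [].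
elim: k => [//|k [/= t_gt0 [next_t med_t]]].
set t := iter k _ _ in t_gt0 next_t med_t *.
have med_t' : median (mm_step t) = median s.
  by rewrite /mm_step next_t -med_t median_rcons_median.
split; first by rewrite size_rcons.
split=> //; rewrite mm_nextE sum_mm_step size_rcons med_t' med_t.
by rewrite [X in X * _]mulrSr; ring.
Qed.

(** Facts about the growing list, on which the symbolic execution runs, thereby
    become facts about the sequence. *)
Lemma mm_seq_prefix s k :
  [seq mm_seq s i | i <- iota 1 (size s + k)] = iter k (@mm_step R) s.
Proof.
elim: k => [|k IHk].
  apply: (@eq_from_nth _ 0) => [|i]; rewrite size_map size_iota addn0 // => lti.
  rewrite (nth_map 0%N) ?size_iota // nth_iota // mm_seq_init //; lia.
rewrite addnS -[(size s + k).+1]addn1 iotaD map_cat IHk /= add1n cats1.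
congr rcons; have [sk0|sk_gt0] := posnP (size s + k).
  by move: sk0 => /eqP; rewrite addn_eq0 => /andP[/nilP-> /eqP->].
rewrite mm_seqS ?leq_addr // IHk /mm_next.
by rewrite -IHk size_map size_iota.
Qed.

Lemma mm_seq_next s k : (0 < size s)%N ->
  mm_seq s (size s + k).+1 = mm_next (iter k (@mm_step R) s).
Proof.
move=> s_gt0; rewrite mm_seqS ?leq_addr ?addn_gt0 ?s_gt0 // mm_seq_prefix.
by rewrite /mm_next -mm_seq_prefix size_map size_iota.
Qed.

End MeanMedian.

(** * Symbolic execution on an interval *)

Delimit Scope Z_scope with coq_Z.

(** Either an endpoint (numerator, denominator) of a piece, or the values that
    a homogeneous linear form takes at its two endpoints. *)
Definition form := (Z * Z)%type.

Definition addf (u v : form) : form := (u.1 + v.1, u.2 + v.2)%coq_Z.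
Definition subf (u v : form) : form := (u.1 - v.1, u.2 - v.2)%coq_Z.
Definition scalef (c : Z) (u : form) : form := (c * u.1, c * u.2)%coq_Z.
Definition lef (u v : form) : bool :=
  (u.1 <=? v.1)%coq_Z && (u.2 <=? v.2)%coq_Z.

(** Halving is partial so that everything stays in the integers; see [scale]
    for why it succeeds. *)
Definition halff (u : form) : option form :=
  if Z.even u.1 && Z.even u.2 then Some (Z.div2 u.1, Z.div2 u.2) else None.

(** [Crossing d] reports a form [d] whose values at the two endpoints have
    opposite signs. *)
Inductive outcome (A : Type) := Done of A | Crossing of form | Stuck.
Arguments Done {A}.
Arguments Crossing {A}.
Arguments Stuck {A}.

Definition bind {A B : Type} (o : outcome A) (f : A -> outcome B) : outcome B :=
  match o with Done a => f a | Crossing d => Crossing d | Stuck => Stuck end.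

Lemma bind_Done {A B : Type} {o : outcome A} {f : A -> outcome B} {y : B} :
  bind o f = Done y -> exists2 a, o = Done a & f a = Done y.
Proof. by case: o => // a; exists a. Qed.

Fixpoint insert (y : form) (t : seq form) : outcome (seq form) :=
  match t with
  | [::] => Done [:: y]
  | e :: t' =>
      if lef y e then Done (y :: t)
      else if lef e y then bind (insert y t') (fun r => Done (e :: r))
      else Crossing (subf y e)
  end.

Definition medianf (t : seq form) : option form :=
  let n := size t in
  if odd n then Some (nth (0, 0)%coq_Z t n./2)
  else halff (addf (nth (0, 0)%coq_Z t n./2.-1) (nth (0, 0)%coq_Z t n./2)).

(** With t of size n, sum S and median m, the next element is (n + 1) m - S,
    and (n + 1) m is the sum of the enlarged list. *)
Fixpoint run (k : nat) (t : seq form) (S : form) : outcome form :=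
  if k isn't k'.+1 then Stuck else
  if medianf t isn't Some m then Stuck else
  let S' := scalef (Z.of_nat (size t).+1) m in
  let y := subf S' S in
  if y == m then Done m else bind (insert y t) (fun t' => run k' t' S').

(** The only divisions are by 2, for medians of lists of even size, and there
    are 30 even sizes between 4 and 62. Multiplying the initial data by 2 ^ 30
    therefore keeps all terms integral. *)
Definition scale : Z := (2 ^ 30)%coq_Z.

(** Positive exactly when [g1], [g2] are linearly independent and [g1] comes
    first, so that the piece between them is a genuine cone. *)
Definition det (g1 g2 : form) : Z := (g2.1 * g1.2 - g1.1 * g2.2)%coq_Z.

(** The forms x and 1 take at the endpoints their numerators and their
    denominators. The fuel 59 is the number of list sizes from 4 to 62. *)
Definition start (g1 g2 : form) : outcome form :=
  if (0 <? det g1 g2)%coq_Z then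
    let x := scalef scale (g1.1, g2.1) in
    let one := scalef scale (g1.2, g2.2) in
    bind (insert x [:: (0, 0)%coq_Z; one; one])
      (fun t => run 59 t (addf x (addf one one)))
  else Stuck.

(** The combination of the endpoints at which the form [d] vanishes, in lowest
    terms to keep the integers small. *)
Definition split (g1 g2 d : form) : form :=
  let h := addf (scalef (Z.abs d.2) g1) (scalef (Z.abs d.1) g2) in
  let g := Z.gcd h.1 h.2 in (h.1 / g, h.2 / g)%coq_Z.

(** The pair [c] encodes the claimed limit (c.1 x + c.2) / 2. The fuel bounds
    the depth of the subdivision. *)
Fixpoint explore (k : nat) (c g1 g2 : form) : bool :=
  if k isn't k'.+1 then false else
  match start g1 g2 with
  | Done m =>
      let f (g : form) := (c.1 * g.1 + c.2 * g.2)%coq_Z in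
      scalef 2 m == scalef scale (f g1, f g2)
  | Crossing d =>
      let h := split g1 g2 d in explore k' c g1 h && explore k' c h g2
  | Stuck => false
  end.

(** The four computations cover the four cases of the limit function. The fuel
    exceeds the depth of every subdivision that they generate. *)
Lemma explore_le_m1_387 : explore 40 (0, 2)%coq_Z (-1, 0)%coq_Z (-1, 387)%coq_Z.
Proof. by vm_cast_no_check (erefl true). Qed.

Lemma explore_m1_387_0 : explore 40 (-387, 1)%coq_Z (-1, 387)%coq_Z (0, 1)%coq_Z.
Proof. by vm_cast_no_check (erefl true). Qed.

Lemma explore_0_1_388 : explore 40 (388, 1)%coq_Z (0, 1)%coq_Z (1, 388)%coq_Z.
Proof. by vm_cast_no_check (erefl true). Qed.

Lemma explore_ge_1_388 : explore 40 (0, 2)%coq_Z (1, 388)%coq_Z (1, 0)%coq_Z.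
Proof. by vm_cast_no_check (erefl true). Qed.

(** * Soundness *)

Section Soundness.
Variable R : realType.

Definition Zr (z : Z) : R := (int_of_Z z)%:~R.

Lemma ZrD a b : Zr (a + b)%coq_Z = Zr a + Zr b.
Proof. by rewrite /Zr -intrD -(raddfD int_of_Z). Qed.

Lemma ZrM a b : Zr (a * b)%coq_Z = Zr a * Zr b.
Proof. by rewrite /Zr -intrM -(rmorphM int_of_Z). Qed.

Lemma ZrB a b : Zr (a - b)%coq_Z = Zr a - Zr b.
Proof. by rewrite /Zr -intrB -(raddfB int_of_Z). Qed.

Lemma Zr_nat n : Zr (Z.of_nat n) = n%:R.
Proof. by case: n => // n; rewrite /Zr /= SuccNat2Pos.id_succ. Qed.

Lemma ler_Zr {a b} : (a <=? b)%coq_Z -> Zr a <= Zr b.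
Proof.
move=> ab; rewrite -subr_ge0 -ZrB -(Z2Nat.id (b - a)); last by lia.
by rewrite Zr_nat ler0n.
Qed.

Lemma Zr_gt0 a : (0 <? a)%coq_Z -> 0 < Zr a.
Proof. by move=> a0; rewrite -(Z2Nat.id a) ?Zr_nat ?ltr0n; lia. Qed.

Section Cone.
Variables a b : R.
Hypotheses (a_ge0 : 0 <= a) (b_ge0 : 0 <= b).

Definition ev (u : form) : R := a * Zr u.1 + b * Zr u.2.

Lemma ev0 : ev (0, 0)%coq_Z = 0. Proof. by rewrite /ev /Zr /= !mulr0 addr0. Qed.
Lemma evD u v : ev (addf u v) = ev u + ev v.
Proof. by rewrite /ev !ZrD; ring. Qed.
Lemma evB u v : ev (subf u v) = ev u - ev v.
Proof. by rewrite /ev !ZrB; ring. Qed.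
Lemma evZ c u : ev (scalef c u) = Zr c * ev u.
Proof. by rewrite /ev !ZrM; ring. Qed.

Lemma ev_half u v : halff u = Some v -> ev v = ev u / 2%:R.
Proof.
rewrite /halff; case: ifP => // /andP[u1 u2] [<-].
have half_even z : Z.even z -> Zr z = 2%:R * Zr (Z.div2 z).
  by move=> /Zeven_bool_iff/Zeven_div2 {1}->; rewrite ZrM.
by rewrite /ev /= (half_even u.1) // (half_even u.2) //; field.
Qed.

Lemma lef_ev u v : lef u v -> ev u <= ev v.
Proof.
by case/andP=> ? ?; apply: lerD; apply: ler_wpM2l => //; apply: ler_Zr.
Qed.

Definition encodes (t : seq form) (s : seq R) : Prop :=
  sorted <=%O (map ev t) /\ perm_eq (map ev t) s.

(** Comparisons of forms hold throughout the cone, so one symbolic insertion is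
    correct for every point of it. *)
Lemma insert_sound {y t t' s} :
  insert y t = Done t' -> encodes t s -> encodes t' (rcons s (ev y)).
Proof.
move=> ins [t_sorted ts].
suff [t'_sorted t'y] : sorted <=%O (map ev t') /\
    perm_eq (map ev t') (ev y :: map ev t).
  split=> //; rewrite (perm_trans t'y) //.
  by rewrite perm_sym perm_rcons perm_cons perm_sym.
elim: t t' t_sorted {s ts} ins => [|e t IHt] t' /=; first by move=> _ [<-].
rewrite (path_sortedE le_trans) => /andP[e_t t_sorted].
case: ifP => [/lef_ev ye [<-]|_] /=.
  by rewrite ye (path_sortedE le_trans) e_t.
case: ifP => // /lef_ev ey; case ins: insert => [r| |] //= -[<-] /=.
have [r_sorted r_perm] := IHt r t_sorted ins.
split; last first.
  rewrite perm_sym -[_ :: _]/([:: ev y] ++ [:: ev e] ++ map ev t) perm_catCA.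
  by rewrite perm_cons perm_sym.
by rewrite (path_sortedE le_trans) (perm_all _ r_perm) /= ey e_t r_sorted.
Qed.

Lemma medianf_sound {t s m} :
  encodes t s -> medianf t = Some m -> median s = ev m.
Proof.
move=> [t_sorted ts]; rewrite (median_of_sorted _ t_sorted ts).
have nth_ev i : (map ev t)`_i = ev (nth (0, 0)%coq_Z t i).
  have [lti|lei] := ltnP i (size t); first by rewrite (nth_map (0, 0)%coq_Z).
  by rewrite !nth_default ?size_map // ev0.
rewrite /medianf /central_value size_map !nth_ev; case: ifP => _.
  by case=> <-.
by move=> /ev_half ->; rewrite evD.
Qed.

(** The symbolic run follows the true orbit step by step, the sum being carried
    along, so the equality on which it stops is a true one. *)
Lemma run_sound {k t S s m} :
  encodes t s -> ev S = \sum_(y <- s) y -> run k t S = Done m ->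
  exists2 j, (j < k)%N &
    mm_next (iter j (@mm_step R) s) = ev m /\
    median (iter j (@mm_step R) s) = ev m.
Proof.
elim: k t S s => [//|k IHk] t S s ts evS /=.
case med: medianf => [m'|//]; set S' := scalef _ _.
have evS' : ev S' = (size s).+1%:R * median s.
  rewrite evZ -[Z.pos _]/(Z.of_nat (size t).+1) Zr_nat (medianf_sound ts med).
  by have [_ /perm_size <-] := ts; rewrite size_map.
have next : ev (subf S' S) = mm_next s by rewrite evB evS' evS mm_nextE.
case: eqP => [y_eq [<-]|_].
  by exists 0%N => //=; rewrite -next y_eq (medianf_sound ts med).
case ins: insert => [t'| |] //= runk.
have ts' : encodes t' (mm_step s).
  by rewrite /mm_step -next; exact: insert_sound ins ts.
have [|j jk] := IHk _ _ _ ts' _ runk; first by rewrite evS' sum_mm_step.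
by rewrite -iterSr; exists j.+1.
Qed.

End Cone.

Definition limit_is (c : form) (x : R) : Prop :=
  forall n, (63 <= n)%N -> Y0x11 n x = (Zr c.1 * x + Zr c.2) / 2%:R.

(** The hypotheses on [x] are the inequalities g1.1 / g1.2 <= x <= g2.1 / g2.2
    cleared of denominators, which remain meaningful at infinity. A cut is
    justified by totality of the order alone; on a piece without crossings,
    Cramer's rule writes (x, 1) as a nonnegative combination of [g1] and [g2]. *)
Lemma explore_sound {k c g1 g2} x : explore k c g1 g2 ->
  Zr g1.1 <= Zr g1.2 * x -> Zr g2.2 * x <= Zr g2.1 -> limit_is c x.
Proof.
elim: k g1 g2 => [//|k IHk] g1 g2 /=.
case st: start => [m|d|//]; last first.
  case/andP=> exl exr lo hi.
  have [hx|/ltW hx] := leP (Zr (split g1 g2 d).2 * x) (Zr (split g1 g2 d).1).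
    exact: IHk exl lo hx.
  exact: IHk exr hx hi.
move=> /eqP m_eq lo hi; move: st; rewrite /start.
have: 0 < Zr scale by exact: Zr_gt0.
(* Only positivity of the scale matters; a variable prevents its unfolding. *)
move: scale m_eq => K m_eq K_gt0.
case: ifP => // /Zr_gt0; rewrite /det ZrB !ZrM => det_gt0.
set D := _ - _ in det_gt0.
move=> /bind_Done[t ins runt].
have div_DK_ge0 y : 0 <= y -> 0 <= y / D / Zr K.
  by move=> y_ge0; rewrite !divr_ge0 // ltW.
(* The coordinates of (x, 1) in the basis g1, g2, up to the scale K. *)
pose a := (Zr g2.1 - Zr g2.2 * x) / D / Zr K.
pose b := (Zr g1.2 * x - Zr g1.1) / D / Zr K.
have a_ge0 : 0 <= a by rewrite div_DK_ge0 ?subr_ge0.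
have b_ge0 : 0 <= b by rewrite div_DK_ge0 ?subr_ge0.
have D_neq0 : D != 0 by rewrite gt_eqF.
have K_neq0 : Zr K != 0 by rewrite gt_eqF.
have ev_one : ev a b (scalef K (g1.2, g2.2)) = 1.
  rewrite evZ /ev /a /b /=; move: D_neq0.
  by rewrite /D => D_neq0; field; rewrite K_neq0.
have ev_x : ev a b (scalef K (g1.1, g2.1)) = x.
  rewrite evZ /ev /a /b /=; move: D_neq0.
  by rewrite /D => D_neq0; field; rewrite K_neq0.
have ev_m : ev a b m = (Zr c.1 * x + Zr c.2) / 2%:R.
  have := congr1 (ev a b) m_eq; rewrite evZ -/(Z.of_nat 2) Zr_nat => ev2.
  apply: (canRL (mulfK _)); rewrite ?pnatr_eq0 // mulrC ev2.
  rewrite -[X in _ * X + _]ev_x -[X in _ + X]mulr1 -[X in _ + _ * X]ev_one.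
  by rewrite !evZ /ev /= !ZrD !ZrM; ring.
set fx := scalef _ _ in ev_x ins runt; set f1 := scalef _ _ in ev_one ins runt.
pose s0 : seq R := [:: 0; x; 1; 1].
have ts : encodes a b t s0.
  have [] := insert_sound a b a_ge0 b_ge0 (s := [:: 0; 1; 1]) ins.
    by split; rewrite /= ev0 ev_one ?lexx ?ler01.
  rewrite ev_x => ? tp; split=> //; apply: (perm_trans tp).
  by rewrite perm_rcons -[s0]/([:: 0] ++ [:: x] ++ [:: 1; 1]) perm_sym perm_catCA.
have sum_eq : ev a b (addf fx (addf f1 f1)) = \sum_(y <- s0) y.
  by rewrite !evD ev_x ev_one !big_cons big_nil; ring.
have [j j_lt [next_j med_j]] := run_sound a b a_ge0 b_ge0 ts sum_eq runt.
move=> n n_ge; rewrite -ev_m -med_j /Y0x11 -/s0.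
(* s0 has 4 elements, so the term of index n is adjoined after n - 5 steps. *)
have -> : n = (size s0 + (n - 5)).+1%N by rewrite /=; lia.
rewrite mm_seq_next // -(subnK (_ : j <= n - 5)%N); last by lia.
rewrite iterD mm_stationary ?next_j ?med_j //.
by rewrite -mm_seq_prefix size_map size_iota.
Qed.

End Soundness.

(** * The limit function *)

Section Limit.
Variable R : realType.

Definition limit_value (x : R) : R :=
  if x <= - (1 / 387%:R) then 1
  else if x < 0 then - (387%:R / 2%:R) * x + 1 / 2%:R
  else if x < 1 / 388%:R then 194%:R * x + 1 / 2%:R
  else 1.

Lemma Y0x11_from_63 n (x : R) : (63 <= n)%N -> Y0x11 n x = limit_value x.
Proof.
have Zr0 : Zr R 0 = 0 by [].
have Zr1 : Zr R 1 = 1 by [].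
have Zr2 : Zr R 2 = 2%:R by [].
have ZrN1 : Zr R (-1) = - 1 by [].
have Zr387 : Zr R 387 = 387%:R by [].
have Zr388 : Zr R 388 = 388%:R by [].
have ZrN387 : Zr R (-387) = - 387%:R by [].
pose ZrE := (Zr0, Zr1, Zr2, ZrN1, Zr387, Zr388, ZrN387).
move=> n_ge; rewrite /limit_value.
have Yx c g1 g2 (ok : explore 40 c g1 g2) lo hi :=
  explore_sound R x ok lo hi n n_ge.
have [x_m1_387|x_m1_387] := lerP x (- (1 / 387%:R)).
  by rewrite (Yx _ _ _ explore_le_m1_387); rewrite /= !ZrE; lra.
have [x_0|x_0] := ltrP x 0.
  by rewrite (Yx _ _ _ explore_m1_387_0); rewrite /= !ZrE; lra.
have [x_1_388|x_1_388] := ltrP x (1 / 388%:R).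
  by rewrite (Yx _ _ _ explore_0_1_388); rewrite /= !ZrE; lra.
by rewrite (Yx _ _ _ explore_ge_1_388); rewrite /= !ZrE; lra.
Qed.

End Limit.

Lemma transit_time_le {R : realType} (Y : nat -> R) t : (0 < t)%N ->
  stationary_from Y t -> (transit_time Y <= (t : int)%:E)%E.
Proof.
move=> t_gt0 Yt; have Pt : transit_pred Y t.
  by rewrite /transit_pred t_gt0; exact/asboolP.
rewrite /transit_time; case: pselect => [ex|[]]; last by exists t.
by rewrite lee_fin lez_nat; case: ex_minnP => k _; exact.
Qed.

Theorem theorem9 (R : realType) :
  strong_terminating (@tau0x11 R) /\
  forall x : R,
    [/\ (tau0x11 x <= (63 : int)%:E)%E,
        cvgn (fun n => Y0x11 n x),
        m0x11 x = Y0x11 63 x &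
        Y0x11 63 x =
          if x <= - (1 / 387%:R) then 1
          else if x < 0 then - (387%:R / 2%:R) * x + 1 / 2%:R
          else if x < 1 / 388%:R then 194%:R * x + 1 / 2%:R
          else 1].
Proof.
have stationary (x : R) : stationary_from (fun n => Y0x11 n x) 63.
  by move=> k; rewrite !Y0x11_from_63.
have tau_le (x : R) : (tau0x11 x <= (63 : int)%:E)%E by exact: transit_time_le.
split=> x; first by rewrite (le_lt_trans (tau_le x)) ?ltry.
have limY : \forall n \near \oo, Y0x11 n x = Y0x11 63 x.
  by exists 63%N => // n /= n_ge; rewrite !Y0x11_from_63.
split; first exact: tau_le.
- exact: is_cvg_near_cst limY.
- exact: lim_near_cst.
- exact: Y0x11_from_63.
Qed.
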